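(* Let $X$ be a finite cell complex of dimension $d$ and $0\le i\le d$, with $\operatorname{rk}\widetilde H_{i+1}(X)=0$, $\operatorname{rk}\widetilde H_i(X)=1$ and $\operatorname{rk}\widetilde H_{i-1}(X)=0$. Let $\lambda=\sum_{U\in\mathcal U_i}w(C_U)\,C_U$ be the $i$-th standard harmonic cycle and $\lambda^*=\sum_{U^*\in\mathcal U^i}c(C_{U^*})\,C_{U^*}$ the standard harmonic cocycle. Then, in $C_i(X;\mathbb Q)$, $$\frac{\lambda}{|\widetilde H_{i-1}(X)|}=\pm\frac{\lambda^*}{|\widetilde H^{i+1}(X)|}.$$
   Context: Notation: $X_j$ is the finite set of $j$-cells of $X$ (in a fixed order), $C_j=C_j(X)$ is the free abelian group on $X_j$ for $0\le j\le d$, $C_{-1}=\mathbb Z$, other $C_j=0$; $\partial_j:C_j\to C_{j-1}$ is the integer cellular boundary matrix, with $\partial_0(x)=1$ for each vertex $x$ (augmented complex); $\delta_j=\partial_{j+1}^t:C_j\to C_{j+1}$. $Z_j=\ker\partial_j$, $B_j=\operatorname{im}\partial_{j+1}$, $Z^j=\ker\delta_j$, $B^j=\operatorname{im}\delta_{j-1}$ (all over $\mathbb Z$), $\widetilde H_j=Z_j/B_j$, $\widetilde H^j=Z^j/B^j$. $\mathcal S_i$ is the set of subcomplexes $Y$ with $X^{i-1}\subseteq Y\subseteq X^i$ ($X^j$ the $j$-skeleton); $Y$ is determined by its set $I(Y)\subseteq X_i$ of $i$-cells. For a basis $Z$ of a lattice, $[\cdot]_Z$ denotes coordinates (column by column)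 in that basis. For an $n\times(n+1)$ matrix $A$, let $v_A$ be the vector with $j$-th entry $(-1)^j\det([A]_j)$, where $[A]_j$ is $A$ with its $j$-th column deleted. $\mathcal U_i$ is the set of $i$-cycletrees: $U\in\mathcal S_i$ with $|I(U)|=\operatorname{rk}Z_{i-1}(X)+1$. Its cycle part $C_U\in Z_i(X)$ is $v_A$ (extended by $0$ outside $I(U)$), $A$ being the columns of $[\partial_i]_Z$ indexed by $I(U)$, $Z$ a $\mathbb Z$-basis of $Z_{i-1}(X)$. $\mathcal U^i$ is the set of $i$-dimensional dual cycletrees: $U^*\in\mathcal S_i$ with $|I(U^* )|=\operatorname{rk}Z^{i+1}(X)+1$. Its cocycle part $C_{U^*}\in Z^i(X)$ is $v_A$ (extended by $0$ outside $I(U^* )$), $A$ being the columns of $[\delta_i]_Z$ indexed by $I(U^* )$, $Z$ a $\mathbb Z$-basis of $Z^{i+1}(X)$. Winding number: $w(z)=\det([z]_Z,[\overline\partial_{i+1}]_Z)$ for $z\in Z_i(X)$, $Z$ a $\mathbb Z$-basis of $Z_i(X)$ and $\overline\partial_{i+1}$ a matrix whose columns form a $\mathbb Z$-basis of $B_i(X)$. Cutting number: $c(z)=\det([z]_Z,[\overline\delta_{i-1}]_Z)$ for $z\in Z^i(X)$, $Z$ a $\mathbb Z$-basis of $Z^i(X)$ and $\overline\delta_{i-1}$ a matrix whose columns form a $\mathbb Z$-basis of $B^i(X)$. Both are well defined up to a global sign. *)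

(* Defs.v *)
(* MathComp with the classical layer of MathComp-Analysis. *)
From HB Require Import structures.
From mathcomp Require Import all_boot all_order all_algebra.
From mathcomp Require Import finmap boolp classical_sets functions cardinality.

Set Implicit Arguments.
Unset Strict Implicit.
Unset Printing Implicit Defensive.

Import GRing.Theory.
Local Open Scope classical_set_scope.
Local Open Scope ring_scope.

(* A finite cell complex of dimension d enters only through its cells, ordered
   as 'I_(ncells j) in each dimension j, and its cellular boundary matrices,
   incid j being the matrix of the (unaugmented) boundary C_(j+1) -> C_j.  The
   fields are properties that hold for every nonempty finite CW complex with
   oriented cells. *)
Record cell_complex (d : nat) := CellComplex {
  ncells : nat -> nat;
  incid : forall j, 'M[int]_(ncells j, ncells j.+1);
  ncells_vertex : (0 < ncells 0)%N;
  ncells_dim : (0 < ncells d)%N;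
  ncells_above : forall j, (d < j)%N -> ncells j = 0%N;
  incid_edge : forall e : 'I_(ncells 1), exists v w : 'I_(ncells 0),
    col e (incid 0) = delta_mx v 0 - delta_mx w 0;
  incid_incid : forall j, incid j *m incid j.+1 = 0
}.

Section ChainComplex.
Variables (d : nat) (X : cell_complex d).

(* Chain groups start in degree -2, so indices are shifted to stay in nat:
   chain_rk k is the rank of C_(k-2), and bdry k is the matrix of
   d_(k-1) : C_(k-1) -> C_(k-2).  Thus C_(-2) = 0, C_(-1) = Z, bdry 1 is the
   augmentation, and the i-cells index C_i since chain_rk i.+2 = ncells i. *)
Definition chain_rk (k : nat) : nat :=
  match k with 0 => 0 | 1 => 1 | j.+2 => ncells X j end.

Definition bdry (k : nat) : 'M[int]_(chain_rk k, chain_rk k.+1) :=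
  match k with
  | 0 => 0
  | 1 => const_mx 1
  | j.+2 => incid X j
  end.

(* cobdry k is the matrix of delta_(k-2) : C_(k-2) -> C_(k-1). *)
Definition cobdry (k : nat) : 'M[int]_(chain_rk k.+1, chain_rk k) := (bdry k)^T.

Lemma bdry_bdry k : bdry k *m bdry k.+1 = 0.
Proof.
case: k => [|[|k]]; [exact: mul0mx | | exact: incid_incid].
apply/matrixP => a e; rewrite [RHS]mxE.
have [v [w vw]] := incid_edge e.
have -> : (const_mx 1 *m incid X 0) a e =
          ((const_mx 1 : 'M_(1, ncells X 0)) *m col e (incid X 0)) a 0.
  by rewrite !mxE; apply: eq_bigr => u _; rewrite !mxE.
rewrite vw mulmxBr -!colE !mxE; exact: subrr.
Qed.

Lemma cobdry_cobdry k : cobdry k.+1 *m cobdry k = 0.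
Proof. by rewrite -trmx_mul bdry_bdry trmx0. Qed.

End ChainComplex.

Definition kerZ (m n : nat) (D : 'M[int]_(m, n)) : set 'cV[int]_n :=
  [set z | D *m z = 0].

Definition imZ (n p : nat) (E : 'M[int]_(n, p)) : set 'cV[int]_n :=
  range (mulmx E : 'cV[int]_p -> 'cV[int]_n).

Section Homology.
Variables (m n p : nat) (D : 'M[int]_(m, n)) (E : 'M[int]_(n, p)).

Definition ker_pred : {pred 'cV[int]_n} := fun z => z \in kerZ D.

Fact ker_pred_zmod : zmod_closed ker_pred.
Proof.
split=> [|x y]; rewrite !unfold_in /=; first by apply/asboolP; exact: mulmx0.
move=> /asboolP Dx /asboolP Dy; apply/asboolP.
by rewrite /kerZ /= mulmxBr Dx Dy subr0.
Qed.

HB.instance Definition _ :=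
  GRing.isZmodClosed.Build 'cV[int]_n ker_pred ker_pred_zmod.

Record ker_group := KerGroup { kerval : 'cV[int]_n; _ : kerval \in ker_pred }.

HB.instance Definition _ := [isSub for kerval].
HB.instance Definition _ := [Choice of ker_group by <:].
HB.instance Definition _ := [SubChoice_isSubZmodule of ker_group by <:].

Definition im_pred : {pred ker_group} := fun z => val z \in imZ E.

Fact im_pred_zmod : zmod_closed im_pred.
Proof.
split=> [|x y]; rewrite !unfold_in /=.
  by apply/asboolP; exists 0 => //; rewrite mulmx0.
move=> /asboolP[a _ Ea] /asboolP[b _ Eb]; apply/asboolP; exists (a - b) => //.
by rewrite mulmxBr Ea Eb.
Qed.

HB.instance Definition _ :=
  GRing.isZmodClosed.Build ker_group im_pred im_pred_zmod.

(* ker D / (im E `&` ker D); in all uses D *m E = 0. *)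
Definition homology : zmodType := Quotient.quot im_pred.

End Homology.

(* With the index shift above, rhomology X k is the reduced homology group in
   degree k-1, and rcohomology X k the reduced cohomology group in degree k-1. *)
Definition rhomology (d : nat) (X : cell_complex d) (k : nat) : zmodType :=
  homology (bdry X k) (bdry X k.+1).

Definition rcohomology (d : nat) (X : cell_complex d) (k : nat) : zmodType :=
  homology (cobdry X k.+1) (cobdry X k).

Definition Zindep (G : zmodType) (r : nat) (x : 'I_r -> G) : Prop :=
  forall a : 'I_r -> int, \sum_k x k *~ a k = 0 -> forall k, a k = 0.

Definition has_rank (G : zmodType) (r : nat) : Prop :=
  (exists x : 'I_r -> G, Zindep x) /\ forall x : 'I_r.+1 -> G, ~ Zindep x.

(* The order of G; the junk value for infinite G is 0. *)
Definition group_order (G : zmodType) : nat := #|` fset_set [set: G] |%fset.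

(* The columns of M form a Z-basis of L. *)
Definition Zbasis (n r : nat) (L : set 'cV[int]_n) (M : 'M[int]_(n, r)) : Prop :=
  injective (mulmx M : 'cV[int]_r -> 'cV[int]_n) /\ imZ M = L.

(* [A]_Z : the matrix K with Z *m K = A (unique when the columns of A lie in
   the lattice with basis Z). *)
Definition coord_mx (m r n : nat) (Z : 'M[int]_(m, r)) (A : 'M[int]_(m, n)) :
  'M[int]_(r, n) := xget 0 [set K | Z *m K = A].

Definition minors_vec (r : nat) (A : 'M[int]_(r, r.+1)) : 'cV[int]_r.+1 :=
  \col_j ((-1) ^+ j * \det (col' j A : 'M[int]_r)).

(* A subcomplex between the (i-1)- and the i-skeleton is given by its set of
   i-cells; here n is the number of i-cells, and r is the rank of Z_(i-1) for
   cycletrees, and the rank of Z^(i+1) for dual cycletrees. *)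
Definition cycletree (n r : nat) := {U : {set 'I_n} | #|U| == r.+1}.

Definition tree_cell (n r : nat) (U : cycletree n r) (k : 'I_r.+1) : 'I_n :=
  enum_val (cast_ord (esym (eqP (valP U))) k).

(* v_A extended by zero outside U, where A consists of the columns of [D]_Z
   indexed by U. *)
Definition tree_vec (m n r : nat) (D : 'M[int]_(m, n)) (Z : 'M[int]_(m, r))
    (U : cycletree n r) : 'cV[int]_n :=
  let v := minors_vec (colsub (tree_cell U) (coord_mx Z D)) in
  \sum_k v k 0 *: delta_mx (tree_cell U k) 0.

Definition lattice_det (n s : nat) (Z : 'M[int]_(n, s.+1)) (B : 'M[int]_(n, s))
    (z : 'cV[int]_n) : int :=
  \det (row_mx (coord_mx Z z) (coord_mx Z B) : 'M[int]_s.+1).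

Section Harmonic.
Variables (d : nat) (X : cell_complex d) (i : nat).
Local Notation Ci := 'cV[int]_(ncells X i).

Definition cycle_part (r : nat) (Z : 'M[int]_(chain_rk X i.+1, r))
    (U : cycletree (ncells X i) r) : Ci := tree_vec (bdry X i.+1) Z U.

Definition cocycle_part (r : nat) (Z : 'M[int]_(chain_rk X i.+3, r))
    (U : cycletree (ncells X i) r) : Ci := tree_vec (cobdry X i.+2) Z U.

(* Z is a basis of Z_i and B a basis of B_i. *)
Definition winding (s : nat) (Z : 'M[int]_(ncells X i, s.+1))
  (B : 'M[int]_(ncells X i, s)) (z : Ci) : int := lattice_det Z B z.

(* Z is a basis of Z^i and B a basis of B^i. *)
Definition cutting (s : nat) (Z : 'M[int]_(ncells X i, s.+1))
  (B : 'M[int]_(ncells X i, s)) (z : Ci) : int := lattice_det Z B z.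

Definition harmonic_cycle (r s : nat) (Zprev : 'M[int]_(chain_rk X i.+1, r))
    (Z : 'M[int]_(ncells X i, s.+1)) (B : 'M[int]_(ncells X i, s)) : Ci :=
  \sum_(U : cycletree (ncells X i) r)
    winding Z B (cycle_part Zprev U) *: cycle_part Zprev U.

Definition harmonic_cocycle (r s : nat) (Znext : 'M[int]_(chain_rk X i.+3, r))
    (Z : 'M[int]_(ncells X i, s.+1)) (B : 'M[int]_(ncells X i, s)) : Ci :=
  \sum_(U : cycletree (ncells X i) r)
    cutting Z B (cocycle_part Znext U) *: cocycle_part Znext U.

End Harmonic.

(* Main.v *)
From mathcomp Require Import finmap boolp classical_sets cardinality.
Require Import Defs.
From mathcomp Require Import all_boot all_order all_algebra.
From mathcomp Require Import perm generic_quotient ring_quotient.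
From mathcomp Require Import ring zify.

Set Implicit Arguments.
Unset Strict Implicit.
Unset Printing Implicit Defensive.

Import GRing.Theory Num.Theory.
Local Open Scope ring_scope.
Local Open Scope quotient_scope.

(** Let n be the number of i-cells, and let A and A' be the matrices of the
    boundary and of the coboundary map on C_i in bases of Z_(i-1) and Z^(i+1).
    Both have independent rows, because the homology in degree i-1 and the
    cohomology in degree i+1 are finite, and A A'^T = 0; together their rows
    span a space of dimension n - 1, whose orthogonal complement is the line of
    harmonic chains.  The linear form x |-> det (x, A'^T, A^T) vanishes on the
    rows of A and A', so it is the product with a harmonic vector eta.  The
    theorem holds because

      lambda = +- h eta   and   lambda^* = +- h' eta,

    where h and h' are the orders of the two finite groups.

    For the first equality, the product of y with C_U is the determinant of the
    columns in U of A bordered by y ([dot_minors_cycle]), so by the Cauchy-Binet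
    formula the sum of the C_U C_U^T is the Gram determinant of A times the
    orthogonal projection to ker A ([sum_minors_cycle]).  On ker A the winding
    number w is +- the product with eta divided by delta = det (Z, A^T), where
    the columns of Z are a basis of Z_i ([lattice_det_bordered]).  Hence
    delta lambda = +- det (A A^T) eta.  The Smith normal form gives A = M P with
    P surjective and |det M| = h ([torsion_homology_factor]), and splitting off
    ker A gives det (A A^T) = +- det M delta ([det_ker_rows]); delta cancels.

    The second equality is the same one with A and A' exchanged
    ([harmonic_sum_complex]).  The finiteness of the cohomology group
    that it needs follows from that of the homology group in degree i+1
    ([torsion_at_tr]).  That the two vectors eta agree up to sign is read off
    from det (x, A'^T, A^T)^2 = det (x x^T + A'^T A' + A^T A), which is
    symmetric in A and A' ([det_bordered_sqr], [eq_sqr_dot]). *)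

(** * Maximal minors and the Cauchy-Binet formula *)

Lemma tree_cell_inj n r (U : cycletree n r) : injective (tree_cell U).
Proof. by move=> k l /enum_val_inj /cast_ord_inj. Qed.

Lemma tree_cell_mem n r (U : cycletree n r) k : tree_cell U k \in val U.
Proof. exact: enum_valP. Qed.

Lemma tree_cell_surj n r (U : cycletree n r) x :
  x \in val U -> exists k, tree_cell U k = x.
Proof.
move=> Ux; exists (cast_ord (eqP (valP U)) (enum_rank_in Ux x)).
by rewrite /tree_cell cast_ordK enum_rankK_in.
Qed.

Lemma im_tree_cell n r (U : cycletree n r) (f : {ffun 'I_r.+1 -> 'I_n}) :
  injective f -> f @: setT = val U ->
  exists s : 'S_r.+1, f = [ffun k => tree_cell U (s k)].
Proof.
move=> inj_f imf.
have /fin_all_exists[g gE] k : exists l, tree_cell U l = f k.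
  by apply: tree_cell_surj; rewrite -imf imset_f.
have inj_g : injective g by move=> k l gkl; apply: inj_f; rewrite -!gE gkl.
by exists (perm inj_g); apply/ffunP => k; rewrite ffunE permE gE.
Qed.

(** An injective map is determined by its image and an ordering of it. *)
Lemma sum_inj_ffun (V : nmodType) n r (F : {ffun 'I_r.+1 -> 'I_n} -> V) :
  \sum_(f : {ffun 'I_r.+1 -> 'I_n} | injectiveb f) F f =
  \sum_(U : cycletree n r) \sum_(s : 'S_r.+1) F [ffun k => tree_cell U (s k)].
Proof.
pose im (f : {ffun 'I_r.+1 -> 'I_n}) := f @: setT.
transitivity (\sum_(f : {ffun 'I_r.+1 -> 'I_n} | injectiveb f)
                \sum_(U : cycletree n r | val U == im f) F f).
  apply: eq_bigr => f /injectiveP inj_f.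
  have cf : #|im f| == r.+1 by rewrite card_imset // cardsT card_ord.
  by rewrite (big_pred1 (exist _ (im f) cf)).
rewrite (exchange_big_dep predT) //=; apply: eq_bigr => U _.
pose h (s : 'S_r.+1) : {ffun 'I_r.+1 -> 'I_n} := [ffun k => tree_cell U (s k)].
have inj_h : injective h.
  move=> s t /ffunP hst; apply/permP => k.
  by have := hst k; rewrite !ffunE => /tree_cell_inj.
have E : [set f : {ffun _} | injectiveb f && (val U == im f)] = h @: setT.
  apply/setP => f; rewrite inE;
    apply/andP/imsetP => [[/injectiveP fi /eqP Uf]|[s _ ->]].
    by have [s ->] := im_tree_cell fi (esym Uf); exists s.
  split.
    by apply/injectiveP => k l; rewrite !ffunE => /tree_cell_inj /perm_inj.
  rewrite eq_sym eqEcard (eqP (valP U)) card_imset;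
    rewrite ?cardsT ?card_ord ?leqnn ?andbT.
    by apply/fintype.subsetP => _ /imsetP[k _ ->]; rewrite ffunE tree_cell_mem.
  by move=> k l; rewrite !ffunE => /tree_cell_inj /perm_inj.
rewrite (eq_bigl (mem (h @: setT))) => [|f]; last by rewrite -E !inE.
rewrite big_imset /=; last by move=> s t _ _; exact: inj_h.
by apply: eq_bigl => s; rewrite inE.
Qed.

(** Each entry of the product is a sum over the columns; choosing one summand
    for every row amounts to a map f from rows to columns. *)
Lemma det_mulmx_tr_ffun (R : comNzRingType) p n (M N : 'M[R]_(p, n)) :
  \det (M *m N^T) =
  \sum_(f : {ffun 'I_p -> 'I_n}) (\prod_i M i (f i)) * \det (colsub f N).
Proof.
transitivity (\sum_(s : 'S_p) \sum_(f : {ffun 'I_p -> 'I_n})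
   (\prod_i M i (f i)) * ((-1) ^+ s * \prod_i N (s i) (f i))).
  apply: eq_bigr => s _.
  under eq_bigr do rewrite mxE.
  rewrite bigA_distr_bigA /= mulr_sumr; apply: eq_bigr => f _.
  rewrite mulrCA big_split; congr (_ * (_ * _)).
  by apply: eq_bigr => i _; rewrite mxE.
rewrite exchange_big; apply: eq_bigr => f _; rewrite -mulr_sumr; congr (_ * _).
rewrite -det_tr; apply: eq_bigr => s _; congr (_ * _).
by apply: eq_bigr => i _; rewrite !mxE.
Qed.

(** The Cauchy-Binet formula.  In the sum over all maps f from rows to columns
    the non-injective f contribute a determinant with two equal columns; the
    injective ones are grouped by their image U, each being the increasing
    enumeration of U composed with a permutation. *)
Lemma cauchy_binet (R : comNzRingType) n r (M N : 'M[R]_(r.+1, n)) :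
  \det (M *m N^T) = \sum_(U : cycletree n r)
    \det (colsub (tree_cell U) M) * \det (colsub (tree_cell U) N).
Proof.
rewrite det_mulmx_tr_ffun (bigID (fun f : {ffun _} => injectiveb f)) /=.
rewrite addrC big1 ?add0r => [|f /injectivePn[k [l neq_kl fkl]]]; last first.
  rewrite -det_tr (determinant_alternate neq_kl) ?mulr0 // => i.
  by rewrite !mxE fkl.
rewrite sum_inj_ffun; apply: eq_bigr => U _.
rewrite [X in X * _]/(\det _) mulr_suml; apply: eq_bigr => s _.
rewrite -[RHS]mulrA mulrCA; congr (_ * _).
  by apply: eq_bigr => k _; rewrite mxE ffunE.
rewrite -det_perm mulrC -[\det (perm_mx s)]det_tr -det_mulmx tr_perm_mx.
congr (\det _).
by rewrite -col_permE; apply/matrixP => i j; rewrite !mxE ffunE ?invgK.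
Qed.

(** The cycle part C_U when A is the matrix of the boundary map in a basis of
    the lattice of cycles one degree below: for A = [D]_Z it is convertible to
    [tree_vec D Z U]. *)
Definition minors_cycle (n r : nat) (A : 'M[int]_(r, n)) (U : cycletree n r) :
    'cV[int]_n :=
  let v := minors_vec (colsub (tree_cell U) A) in
  \sum_k v k 0 *: delta_mx (tree_cell U k) 0.

(** Laplace expansion along the top row: pairing with the vector of signed
    minors borders the matrix by the other vector.  All that follows uses C_U
    through this formula only. *)
Lemma dot_minors_cycle n r (A : 'M[int]_(r, n)) (U : cycletree n r)
    (y : 'cV[int]_n) :
  (y^T *m minors_cycle A U) 0 0 =
  \det (colsub (tree_cell U) (col_mx y^T A : 'M_(r.+1, n))).
Proof.
rewrite (expand_det_row _ (0 : 'I_r.+1)) mulmx_sumr summxE.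
apply: eq_bigr => k _.
rewrite -scalemxAr -colE [LHS]mxE mulrC; congr (_ * _); last first.
  rewrite mxE /cofactor; congr (_ * \det _).
  by apply/matrixP => i j; rewrite !mxE -rshift1 (unsplitK (inr i)).
have -> : (0 : 'I_r.+1) = lshift r (0 : 'I_1) by apply: val_inj.
by rewrite !mxE (unsplitK (inl _)) mxE.
Qed.

Lemma mulmx_minors_cycle n r (A : 'M[int]_(r, n)) (U : cycletree n r) :
  A *m minors_cycle A U = 0.
Proof.
apply/colP => i; rewrite [RHS]mxE.
have -> : (A *m minors_cycle A U) i 0 =
    (((row i A)^T)^T *m minors_cycle A U) 0 0.
  by rewrite trmxK -row_mul [RHS]mxE.
rewrite dot_minors_cycle.
apply: (determinant_alternate (i1 := lshift r (0 : 'I_1)) (i2 := rshift 1 i))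
  => [//|j].
by rewrite !mxE (unsplitK (inl _)) (unsplitK (inr _)) !mxE.
Qed.

(** Cauchy-Binet for A bordered by x and by y.  For independent rows this says
    that the sum of the C_U C_U^T is det (A A^T) times the orthogonal
    projection to ker A. *)
Lemma sum_minors_cycle n r (A : 'M[int]_(r, n)) (x y : 'cV[int]_n) :
  \sum_(U : cycletree n r)
     (x^T *m minors_cycle A U) 0 0 * (y^T *m minors_cycle A U) 0 0 =
  \det (block_mx (x^T *m y) (x^T *m A^T) (A *m y) (A *m A^T)).
Proof.
under eq_bigr do rewrite !dot_minors_cycle.
transitivity (\det (col_mx x^T A *m (col_mx y^T A)^T)).
  exact/esym/(cauchy_binet (col_mx x^T A : 'M_(r.+1, n))
                           (col_mx y^T A : 'M_(r.+1, n))).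
by rewrite tr_col_mx trmxK mul_col_row.
Qed.

(** * The linear form spanning the harmonic line *)

(** The square matrix with columns x, A'^T and A^T.  As a function of x its
    determinant is a linear form that kills the row spaces of A and A', so when
    the rows are independent and n = 1 + s + r it is represented by a vector
    spanning the line orthogonal to all of them. *)
Definition bordered (n r s : nat) (A : 'M[int]_(r, n)) (A' : 'M[int]_(s, n))
  (x : 'cV[int]_n) : 'M[int]_(n, 1 + s + r) := row_mx (row_mx x A'^T) A^T.

(** Expand along the first column: its cofactors do not involve x, so they can
    be computed at x = 0. *)
Lemma det_bordered_dot r s (A : 'M[int]_(r, 1 + s + r))
    (A' : 'M[int]_(s, 1 + s + r)) :
  exists eta : 'cV[int]_(1 + s + r),
    forall x, \det (bordered A A' x) = (eta^T *m x) 0 0.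
Proof.
pose j := lshift r (lshift s (0 : 'I_1)).
exists (\col_k cofactor (bordered A A' 0) k j) => x.
rewrite (expand_det_col _ j) mxE; apply: eq_bigr => k _.
rewrite [_^T _ _]mxE [X in _ = X * _]mxE mulrC; congr (_ * _); last first.
  by rewrite !mxE (unsplitK (inl _)) !mxE (unsplitK (inl _)).
rewrite /cofactor; congr (_ * \det _); apply/matrixP => a b; rewrite !mxE.
case: split_ordP => // c bc; rewrite !mxE; case: split_ordP => // e ce.
by have := neq_lift j b; rewrite bc ce (ord1 e) eqxx.
Qed.

(** The Gram matrix of the rows is symmetric in A and A', which is why the
    cycle and the cocycle side produce the same vector up to sign. *)
Lemma det_bordered_sqr r s (A : 'M[int]_(r, 1 + s + r))
    (A' : 'M[int]_(s, 1 + s + r)) x :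
  \det (bordered A A' x) ^+ 2 = \det (x *m x^T + A'^T *m A' + A^T *m A).
Proof.
rewrite expr2 -{2}det_tr -det_mulmx /bordered !tr_row_mx !trmxK.
by rewrite !mul_row_col.
Qed.

(** A column operation replaces the first column by 0. *)
Lemma det_bordered_row_space r s (A : 'M[int]_(r, 1 + s + r))
    (A' : 'M_(s, 1 + s + r)) (w : 'cV[int]_r) :
  \det (bordered A A' (A^T *m w)) = 0.
Proof.
have [eta etaE] := det_bordered_dot A A'.
have -> : bordered A A' (A^T *m w) =
    bordered A A' 0 *m block_mx 1%:M 0 (row_mx w 0) 1%:M.
  rewrite /bordered mul_row_block !mulmx1 mulmx0 add0r mul_mx_row mulmx0.
  by rewrite add_row_mx add0r addr0.
by rewrite det_mulmx etaE mulmx0 mxE mul0r.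
Qed.

Lemma eq_dot n (x y : 'cV[int]_n) :
  (forall z : 'cV[int]_n, (z^T *m x) 0 0 = (z^T *m y) 0 0) -> x = y.
Proof.
move=> xy; apply/colP => i; have := xy (delta_mx i 0).
by rewrite trmx_delta -!rowE !mxE.
Qed.

(** Polarization: the squares determine all products x_k x_l, hence x up to
    sign. *)
Lemma eq_sqr_dot n (x y : 'cV[int]_n) :
  (forall z : 'cV[int]_n, (x^T *m z) 0 0 ^+ 2 = (y^T *m z) 0 0 ^+ 2) ->
  x = y \/ x = - y.
Proof.
move=> xy.
have dotD (u : 'cV[int]_n) k l :
    (u^T *m (delta_mx k 0 + delta_mx l 0 : 'cV_n)) 0 0 = u k 0 + u l 0.
  by rewrite mulmxDr -!colE !mxE.
have sq k : x k 0 ^+ 2 = y k 0 ^+ 2.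
  by have := xy (delta_mx k 0); rewrite -!colE !mxE.
have prod k l : x k 0 * x l 0 = y k 0 * y l 0.
  have := xy (delta_mx k 0 + delta_mx l 0); rewrite !dotD !sqrrD !sq.
  by lia.
have [x0|/cV0Pn[k nz_xk]] := eqVneq x 0.
  left; rewrite x0; apply/colP => k; have := sq k.
  by rewrite x0 !mxE expr0n => /esym/eqP; rewrite sqrf_eq0 => /eqP.
have /eqP := sq k; rewrite eqf_sqr => /orP[] /eqP xyk; [left | right];
  apply/colP => l; apply: (mulfI nz_xk); rewrite prod ?mxE xyk //.
by rewrite mulrNN.
Qed.

(** * Bases of lattices and kernels *)

Lemma imZ_factor m n p (Z : 'M[int]_(m, n)) (A : 'M[int]_(m, p)) :
  (forall x, imZ Z (A *m x)) -> exists K, Z *m K = A.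
Proof.
move=> ZA; have /fin_all_exists[K KE] j : exists k, Z *m k = col j A.
  by have [k _ kE] := ZA (delta_mx j 0); exists k; rewrite kE colE.
exists (\matrix_(i, j) K j i 0); apply/matrixP => i j.
have /colP/(_ i) := KE j; rewrite !mxE => <-.
by apply: eq_bigr => l _; rewrite !mxE.
Qed.

Lemma mulmx_inj_mx m n p (Z : 'M[int]_(m, n)) (X Y : 'M[int]_(n, p)) :
  injective (mulmx Z : 'cV_n -> 'cV_m) -> Z *m X = Z *m Y -> X = Y.
Proof.
move=> inj_Z ZXY; apply/matrixP => i j.
suff /colP/(_ i) : col j X = col j Y by rewrite !mxE.
by apply: inj_Z; rewrite !colE !mulmxA ZXY.
Qed.

Lemma coord_mxK m n p (Z : 'M[int]_(m, n)) (A : 'M[int]_(m, p)) :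
  (forall x, imZ Z (A *m x)) -> Z *m coord_mx Z A = A.
Proof.
move=> /imZ_factor[K KE].
have : [set K | Z *m K = A]%classic (coord_mx Z A); last exact.
by apply: xgetPex; exists K.
Qed.

Lemma coord_mx_unique m n p (Z : 'M[int]_(m, n)) (A : 'M[int]_(m, p)) K :
  injective (mulmx Z : 'cV_n -> 'cV_m) -> Z *m K = A -> coord_mx Z A = K.
Proof.
move=> inj_Z KE; apply: (mulmx_inj_mx inj_Z); rewrite coord_mxK // => x.
by exists (K *m x); rewrite // mulmxA KE.
Qed.

Lemma mulmx_linv_inj m n p (T : 'M[int]_(n, m)) (Z : 'M[int]_(m, n)) :
  T *m Z = 1%:M -> injective (mulmx Z : 'M_(n, p) -> 'M_(m, p)).
Proof. by move=> TZ x y /(congr1 (mulmx T)); rewrite !mulmxA TZ !mul1mx. Qed.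

Lemma mulmx_det_inj r (M : 'M[int]_r) :
  \det M != 0 -> injective (mulmx M : 'cV_r -> 'cV_r).
Proof.
move=> nzM x y /(congr1 (mulmx (\adj M))).
by rewrite !mulmxA mul_adj_mx !mul_scalar_mx => /(scalemx_inj nzM).
Qed.

Lemma sqr_unitz (e : int) : e \is a GRing.unit -> e ^+ 2 = 1.
Proof. by rewrite unfold_in => /orP[] /eqP ->. Qed.

Lemma Zbasis_factor n r s (L : set 'cV[int]_n) (B : 'M[int]_(n, r))
    (C : 'M[int]_(n, s)) :
  Zbasis L B -> imZ C = L -> exists g h, C *m g = B /\ h *m g = 1%:M.
Proof.
move=> [inj_B imB] imC.
have [g gE] : exists g, C *m g = B.
  by apply: imZ_factor => x; rewrite imC -imB; exists x.
have [h hE] : exists h, B *m h = C.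
  by apply: imZ_factor => x; rewrite imB -imC; exists x.
exists g, h; split=> //; apply: (mulmx_inj_mx inj_B).
by rewrite mulmxA hE gE mulmx1.
Qed.

Lemma Zbasis_size n r s (L : set 'cV[int]_n) (B : 'M[int]_(n, r))
    (C : 'M[int]_(n, s)) :
  Zbasis L B -> Zbasis L C -> r = s.
Proof.
move=> bB bC; apply/eqP; rewrite eqn_leq.
have [g [h [_ /mulmx1_min ->]]] := Zbasis_factor bB bC.2.
by have [g' [h' [_ /mulmx1_min ->]]] := Zbasis_factor bC bB.2.
Qed.

(** The columns of 1 - e lie in ker e, so they factor through the basis Z. *)
Lemma idem_ker_linv n r (e : 'M[int]_n) (Z : 'M[int]_(n, r)) :
  e *m e = e -> Zbasis (kerZ e) Z ->
  exists T, T *m Z = 1%:M /\ Z *m T = 1%:M - e.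
Proof.
move=> ee [inj_Z imZE].
have [T TE] : exists T, Z *m T = 1%:M - e.
  apply: imZ_factor => x; rewrite imZE /kerZ /=.
  by rewrite mulmxA mulmxBr ee mulmx1 subrr mul0mx.
have eZ : e *m Z = 0.
  apply/matrixP => i j; have : kerZ e (Z *m delta_mx j 0).
    by rewrite -imZE; exists (delta_mx j 0).
  by rewrite /kerZ /= mulmxA -colE => /colP/(_ i); rewrite !mxE.
exists T; split=> //; apply: (mulmx_inj_mx inj_Z).
by rewrite mulmxA TE mulmxBl eZ subr0 mul1mx mulmx1.
Qed.

(** A kernel is a direct summand: in Smith normal form it is spanned by the
    basis vectors whose diagonal entry vanishes, and e is the projection to
    the span of the other ones. *)
Lemma ker_idem m n (D : 'M[int]_(m, n)) :
  exists e : 'M[int]_n, e *m e = e /\ kerZ e = kerZ D.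
Proof.
have [L uL [R uR [ds _ DE]]] := int_Smith_normal_form D.
pose b (k : nat) := (k < m)%N && (ds`_k != 0).
pose S : 'M[int]_n := diag_mx (\row_k (b k)%:R).
have SS : S *m S = S.
  rewrite mul_diag_mx; apply/matrixP => i j; rewrite !mxE.
  by case: (b i); rewrite ?mul1r // mul0r mul0rn.
exists (invmx R *m S *m R); split.
  by rewrite !mulmxA mulmxK // -(mulmxA (invmx R) S S) SS.
have kerS (y : 'cV[int]_n) :
    S *m y = 0 <-> (\matrix_(i < m, j < n) (ds`_i *+ (i == j :> nat))) *m y = 0.
  rewrite mul_diag_mx; split=> [Sy|Dy].
    apply/colP => i; rewrite !mxE big1 // => j _; rewrite !mxE.
    have [ij|] := eqVneq (i : nat) j; last by rewrite mul0r.
    have /colP/(_ j) := Sy; rewrite !mxE /b -ij ltn_ord.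
    by have [->|_] := eqVneq; rewrite ?mul0r // mul1r => ->; rewrite mulr0.
  apply/colP => k; rewrite !mxE.
  have [/andP[km nz_d]|_] := boolP (b k); last by rewrite mul0r.
  have /colP/(_ (Ordinal km)) := Dy; rewrite !mxE (bigD1 k) //= big1 => [|j].
    rewrite !mxE eqxx addr0 mulr1n => /eqP.
    by rewrite mulf_eq0 (negPf nz_d) mul1r => /eqP.
  by rewrite !mxE -val_eqE eq_sym /= => /negPf ->; rewrite mulr0n mul0r.
rewrite /kerZ; apply/seteqP; split=> x /=; rewrite ?DE -!mulmxA.
  move=> /(congr1 (mulmx R)); rewrite mulmx0 mulKVmx // => /kerS ->.
  by rewrite mulmx0.
move=> /(congr1 (mulmx (invmx L))); rewrite mulmx0 mulKmx // => /kerS ->.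
by rewrite mulmx0.
Qed.

Lemma ker_basis_linv m n r (D : 'M[int]_(m, n)) (Z : 'M[int]_(n, r)) :
  Zbasis (kerZ D) Z -> exists T, T *m Z = 1%:M.
Proof.
have [e [ee <-]] := ker_idem D; move=> /(idem_ker_linv ee)[T [TZ _]].
by exists T.
Qed.

(** * Torsion homology groups and their orders *)

Lemma rank0_torsion (G : zmodType) : has_rank G 0 ->
  forall x : G, exists a : int, a != 0 /\ x *~ a = 0.
Proof.
move=> [_ dep] x; apply: contrapT => tf; apply: (dep (fun=> x)) => a.
rewrite big_ord1 => xa k; rewrite (ord1 k).
by have [//|nz_a] := eqVneq (a 0) 0; case: tf; exists (a 0).
Qed.

(** The homology of D and E at the middle term is a torsion group, expressed
    on the level of vectors. *)
Definition torsion_at (m n p : nat) (D : 'M[int]_(m, n)) (E : 'M[int]_(n, p)) :=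
  forall z, D *m z = 0 -> exists a : int, a != 0 /\ imZ E (a *: z).

Lemma im_predE m n p (D : 'M[int]_(m, n)) (E : 'M[int]_(n, p))
    (u : ker_group D) :
  reflect (imZ E (val u)) (u \in @im_pred m n p D E).
Proof. by rewrite unfold_in; exact: asboolP. Qed.

Lemma ker_predP m n (D : 'M[int]_(m, n)) z :
  reflect (D *m z = 0) (z \in ker_pred D).
Proof. by rewrite unfold_in; exact: asboolP. Qed.

Lemma homology_torsion m n p (D : 'M[int]_(m, n)) (E : 'M[int]_(n, p)) :
  has_rank (homology D E) 0 -> torsion_at D E.
Proof.
move=> /rank0_torsion tor z /ker_predP kz.
have [a [nz_a]] := tor (\pi_(homology D E) (KerGroup kz)).
rewrite -raddfMz => /eqP; rewrite -[X in _ == X](raddf0 \pi_(homology D E)).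
rewrite -Quotient.idealrBE subr0 => /im_predE.
rewrite raddfMz /= -scaler_int intz; by exists a.
Qed.

Lemma clear_denominators n (v : 'rV[rat]_n) :
  exists (a : int) (w : 'rV[int]_n), a != 0 /\ a%:~R *: v = map_mx intr w.
Proof.
exists (\prod_j denq (v 0 j)).
exists (\row_j (numq (v 0 j) * \prod_(k | k != j) denq (v 0 k))).
split; first by apply/prodf_neq0 => j _; exact: denq_neq0.
apply/rowP => j; rewrite !mxE (bigD1 j) //= !rmorphM /=.
rewrite -{2}[v 0 j]divq_num_den mulrAC; congr (_ * _).
by rewrite mulrC divfK // intr_eq0 denq_neq0.
Qed.

Lemma map_intr_inj m n (A B : 'M[int]_(m, n)) :
  map_mx (intr : int -> rat) A = map_mx intr B -> A = B.
Proof.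
move=> /matrixP AB; apply/matrixP => i j; have := AB i j; rewrite !mxE.
exact: intr_inj.
Qed.

(** Rational homology and cohomology have the same rank.  Over the rationals
    exactness at the middle term is the equality rk D + rk E = n, which is
    invariant under transposition. *)
Lemma torsion_at_tr m n p (D : 'M[int]_(m, n)) (E : 'M[int]_(n, p)) :
  D *m E = 0 -> torsion_at D E -> torsion_at E^T D^T.
Proof.
move=> DE tor; pose Dq := map_mx (intr : int -> rat) D.
pose Eq := map_mx (intr : int -> rat) E.
have kerD : (kermx Dq^T <= Eq^T)%MS.
  apply/rV_subP => v /sub_kermxP vD.
  have [a [w [nz_a aw]]] := clear_denominators v.
  have Dw : D *m w^T = 0.
    apply: map_intr_inj.
    by rewrite map_mxM map_mx0 -map_trmx -aw -[_ *m _]trmxK trmx_mul trmxK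
      -scalemxAl vD scaler0 trmx0.
  have [b [nz_b [u _ Eu]]] := tor _ Dw.
  have nz : ((b * a)%:~R : rat) != 0 by rewrite intr_eq0 mulf_neq0.
  rewrite -(eqmx_scale _ nz); apply/submxP; exists (map_mx intr u^T).
  rewrite rmorphM -scalerA aw map_trmx -map_mxM -trmx_mul Eu.
  by apply/rowP => j; rewrite !mxE rmorphM.
have DEq : Dq *m Eq = 0 by rewrite -map_mxM DE map_mx0.
have kerE : (kermx Eq <= Dq)%MS.
  have sD : (Dq <= kermx Eq)%MS by apply/sub_kermxP.
  rewrite -(geq_leqif (mxrank_leqif_sup sD)) mxrank_ker.
  by have := mxrankS kerD; rewrite mxrank_ker !mxrank_tr; lia.
move=> z Ez.
have /submx_trans/(_ kerE)/submxP[u uE] : (map_mx intr z^T <= kermx Eq)%MS.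
  apply/sub_kermxP; rewrite -map_mxM -[z^T *m E]trmxK trmx_mul trmxK Ez.
  by rewrite trmx0 map_mx0.
have [a [w [nz_a aw]]] := clear_denominators u.
exists a; split=> //; exists w^T => //; apply: map_intr_inj.
rewrite -trmx_mul -map_trmx map_mxM -aw -scalemxAl -uE.
by apply/colP => j; rewrite !mxE rmorphM.
Qed.

Lemma group_order_card (G : zmodType) (T : finType) (f : T -> G) :
  injective f -> (forall y, exists x, f x = y) -> group_order G = #|T|.
Proof.
move=> inj_f surj_f; rewrite /group_order.
have -> : [set: G]%classic = [set` [fset f x | x in T]%fset]%classic.
  apply/seteqP; split=> // y _; have [x <-] := surj_f y.
  by rewrite /=; apply/imfsetP; exists x.
by rewrite set_fsetK card_imfset //= -cardE.
Qed.

(** The Smith normal form of a matrix with torsion cokernel has a nonzero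
    pivot in every row; P consists of the first r rows of its right unimodular
    factor, and so has a right inverse Q. *)
Lemma torsion_coker_smith r p (A : 'M[int]_(r, p)) :
  (forall z : 'cV_r, exists a : int, a != 0 /\ imZ A (a *: z)) ->
  exists L (d : 'rV[int]_r) P Q, [/\ L \in unitmx, forall k, d 0 k != 0,
    A = L *m diag_mx d *m P & P *m Q = 1%:M].
Proof.
move=> tor; have [L uL [R uR [ds _ AE]]] := int_Smith_normal_form A.
set S := \matrix_(i, j) _ in AE.
have pivot (k : 'I_r) : (k < p)%N /\ ds`_k != 0.
  have [a [nz_a [w _ Aw]]] := tor (L *m delta_mx k 0).
  have /colP/(_ k) : a *: delta_mx k 0 = S *m (R *m w).
    by rewrite -[LHS](mulKmx uL) -scalemxAr -Aw AE !mulmxA mulVmx // mul1mx.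
  rewrite !mxE !eqxx mulr1 => aE.
  suff [j kj nz_d] : exists2 j : 'I_p, k = j :> nat & ds`_k != 0.
    by rewrite kj in nz_d *.
  apply: contrapT => none; case/eqP: nz_a.
  rewrite aE big1 // => j _; rewrite mxE.
  case: eqP => [kj|_]; last by rewrite mulr0n mul0r.
  have [->|nz_d] := eqVneq ds`_k 0; first by rewrite mul0rn mul0r.
  by case: none; exists j.
have le_rp : (r <= p)%N.
  rewrite leqNgt; apply/negP => lt_pr.
  by have [] := pivot (Ordinal lt_pr); rewrite ltnn.
pose d : 'rV[int]_r := \row_k ds`_k.
have SE : S = diag_mx d *m pid_mx r.
  rewrite mul_diag_mx; apply/matrixP => i j; rewrite !mxE ltn_ord andbT.
  by rewrite mulr_natr.
exists L, d, (pid_mx r *m R), (invmx R *m pid_mx r); split=> //.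
- by move=> k; rewrite mxE; case: (pivot k).
- by rewrite {1}AE SE !mulmxA.
- by rewrite mulmxA mulmxK // pid_mx_id // pid_mx_1.
Qed.

Lemma eq_of_dvdz_sub (d : int) (a b : nat) :
  a%:Z - b%:Z \in dvdz d -> (a < `|d|)%N -> (b < `|d|)%N -> a = b.
Proof.
move=> /dvdzP[q qE] lt_a lt_b.
have : (`|q| * `|d| < `|d|)%N by rewrite -abszM -qE; lia.
rewrite -{2}[absz d]mul1n ltn_mul2r => /andP[_ q_lt1].
have q0 : q = 0 by lia.
by move: qE; rewrite q0 mul0r; lia.
Qed.

(** Every class has a unique representative Z L x with 0 <= x_k < |d_k|. *)
Lemma homology_order m n p r (D : 'M[int]_(m, n)) (E : 'M[int]_(n, p))
    (Z : 'M[int]_(n, r)) L (d : 'rV[int]_r) P Q :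
  Zbasis (kerZ D) Z -> L \in unitmx -> (forall k, d 0 k != 0) ->
  E = Z *m (L *m diag_mx d *m P) -> P *m Q = 1%:M ->
  (group_order (homology D E) = \prod_k `|d 0%R k|)%N.
Proof.
move=> [inj_Z imZE] uL nz_d EE PQ.
have ker_Z x : Z *m (L *m x) \in ker_pred D.
  have : kerZ D (Z *m (L *m x)) by rewrite -imZE; exists (L *m x).
  by move/ker_predP.
pose c x : homology D E := \pi_(homology D E) (KerGroup (ker_Z x)).
have c_eq x y : c x = c y -> forall k, x k 0 - y k 0 \in dvdz (d 0 k).
  move=> /eqP; rewrite -Quotient.idealrBE => /im_predE[w _].
  rewrite /= -!mulmxBr EE -!mulmxA => /inj_Z.
  move=> /(congr1 (mulmx (invmx L))); rewrite !mulKmx // => dw k.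
  have /colP/(_ k) := dw; rewrite mul_diag_mx !mxE => <-.
  exact: dvdz_mulr.
have c_mod (x y : 'cV_r) :
    (forall k, x k 0 - y k 0 \in dvdz (d 0 k)) -> c x = c y.
  move=> dxy; apply/eqP; rewrite -Quotient.idealrBE; apply/im_predE.
  have /fin_all_exists[q qE] k : exists q, x k 0 - y k 0 = d 0 k * q.
    by have /dvdzP[q qE] := dxy k; exists q; rewrite qE mulrC.
  exists (Q *m \col_k q k) => //=.
  rewrite EE -!mulmxBr -!mulmxA; congr (_ *m (_ *m _)).
  rewrite (mulmxA P) PQ mul1mx mul_diag_mx; apply/colP => k.
  by rewrite !mxE -qE.
pose T := {dffun forall k : 'I_r, 'I_(`|d 0 k|)}.
pose f (t : T) := c (\col_k (t k : nat)%:Z).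
rewrite (@group_order_card _ T f).
- rewrite card_dep_ffun foldrE big_map big_enum.
  by apply: eq_bigr => k _; rewrite card_ord.
- move=> t t' /c_eq tt'; apply/ffunP => k; apply: val_inj => /=.
  have := tt' k; rewrite !mxE => /eq_of_dvdz_sub; exact.
- elim/quotW => -[z kz]; have Dz := ker_predP _ _ kz.
  have [v _ vE] : imZ Z z by rewrite imZE.
  have mod_lt k : (`|modz ((invmx L *m v) k 0%R) (d 0%R k)| < `|d 0%R k|)%N.
    by have := ltz_mod ((invmx L *m v) k 0) (nz_d k);
       have := modz_ge0 ((invmx L *m v) k 0) (nz_d k); lia.
  exists [ffun k => Ordinal (mod_lt k)]; rewrite /f.
  transitivity (c (invmx L *m v)).
    apply: c_mod => k; rewrite [X in X - _]mxE ffunE /= gez0_abs ?modz_ge0 //.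
    by rewrite -[_ \in _]eqz_mod_dvd modz_mod.
  by congr (\pi _); apply: val_inj; rewrite /= mulKVmx.
Qed.

(** The factorization A = M P turns A into a surjection P followed by a
    square matrix M, whose determinant is the order of the homology group up
    to sign. *)
Lemma torsion_homology_factor m n p r (D : 'M[int]_(m, n)) (E : 'M[int]_(n, p))
    (Z : 'M[int]_(n, r)) (A : 'M[int]_(r, p)) :
  Zbasis (kerZ D) Z -> E = Z *m A -> torsion_at D E ->
  exists M P Q, [/\ A = M *m P, P *m Q = 1%:M, \det M != 0 &
    `|\det M| = (group_order (homology D E))%:Z].
Proof.
move=> bZ EE tor; have [inj_Z imZE] := bZ.
have [z|L [d [P [Q [uL nz_d AE PQ]]]]] := torsion_coker_smith (A := A).
  have kz : kerZ D (Z *m z) by rewrite -imZE; exists z.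
  have [a [nz_a [w _ Ew]]] := tor _ kz; exists a; split=> //; exists w => //.
  by apply: inj_Z; rewrite mulmxA -EE Ew scalemxAr.
exists (L *m diag_mx d), P, Q.
have unitL : `|\det L| = 1.
  by move: uL; rewrite unitmxE unfold_in => /orP[] /eqP ->.
have absM : `|\det (L *m diag_mx d)| = (group_order (homology D E))%:Z.
  rewrite (homology_order bZ uL nz_d _ PQ) -?AE //.
  rewrite det_mulmx normrM unitL mul1r det_diag normr_prod.
  by rewrite (big_morph Posz PoszM (erefl _)).
split=> //.
rewrite -normr_gt0 det_mulmx normrM unitL mul1r normr_gt0 det_diag.
by apply/prodf_neq0 => k _.
Qed.

(** * The weighted sum of minors *)

(** Z and Q split the exact sequence 0 -> ker A -> Z^n -> P(Z^n) -> 0. *)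
Lemma ker_splitting n r t (A : 'M[int]_(r, n)) M P Q (Z : 'M[int]_(n, t)) :
  A = M *m P -> P *m Q = 1%:M -> \det M != 0 -> Zbasis (kerZ A) Z ->
  exists T, [/\ T *m Z = 1%:M, P *m Z = 0 & Z *m T + Q *m P = 1%:M].
Proof.
move=> AE PQ nzM bZ; have inj_M := mulmx_det_inj nzM.
have kerE : kerZ (Q *m P) = kerZ A.
  rewrite AE /kerZ; apply/seteqP; split=> x /=.
    move=> /(congr1 (mulmx (M *m P))).
    by rewrite mulmx0 -!mulmxA (mulmxA P) PQ mul1mx.
  rewrite -mulmxA => MPx; rewrite -mulmxA.
  have -> : P *m x = 0 by apply: inj_M; rewrite MPx mulmx0.
  exact: mulmx0.
have QPid : (Q *m P) *m (Q *m P) = Q *m P.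
  by rewrite mulmxA -(mulmxA Q) PQ mulmx1.
have [T [TZ ZT]] : exists T, T *m Z = 1%:M /\ Z *m T = 1%:M - Q *m P.
  by apply: idem_ker_linv => //; rewrite kerE.
have PZT : P *m Z *m T = 0.
  by rewrite -mulmxA ZT mulmxBr mulmx1 mulmxA PQ mul1mx subrr.
exists T; split=> //; last by rewrite ZT subrK.
by rewrite -[P *m Z]mulmx1 -TZ mulmxA PZT mul0mx.
Qed.

Lemma ker_basis_size n r t (A : 'M[int]_(r, n)) M P Q (Z : 'M[int]_(n, t)) :
  A = M *m P -> P *m Q = 1%:M -> \det M != 0 -> Zbasis (kerZ A) Z ->
  n = (t + r)%N.
Proof.
move=> AE PQ nzM bZ; have [T [TZ PZ ZTQP]] := ker_splitting AE PQ nzM bZ.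
have TQ : T *m Q = 0.
  apply: (mulmx_inj_mx bZ.1); rewrite mulmx0 mulmxA.
  by rewrite (canRL (addrK _) ZTQP) mulmxBl mul1mx -mulmxA PQ mulmx1 subrr.
apply/eqP; rewrite eqn_leq.
rewrite (mulmx1_min (_ : row_mx Z Q *m col_mx T P = 1%:M)) ?mul_row_col //=.
rewrite (mulmx1_min (_ : col_mx T P *m row_mx Z Q = 1%:M)) // mul_col_row.
by rewrite TZ TQ PZ PQ -scalar_mx_block.
Qed.

(** The unimodular matrix with rows T, P maps the columns Z, A^T to a block
    triangular matrix with diagonal blocks 1 and P A^T, while
    det (A A^T) = det M det (P A^T).  This is where the order of the homology
    group enters. *)
Lemma det_ker_rows r t (A : 'M[int]_(r, t + r)) M P Q (Z : 'M[int]_(t + r, t)) :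
  A = M *m P -> P *m Q = 1%:M -> \det M != 0 -> Zbasis (kerZ A) Z ->
  exists e : int, e ^+ 2 = 1 /\
    \det (A *m A^T) = e * \det M * \det (row_mx Z A^T).
Proof.
move=> AE PQ nzM bZ; have [T [TZ PZ ZTQP]] := ker_splitting AE PQ nzM bZ.
exists (\det (col_mx T P)); split.
  have inv : row_mx Z Q *m col_mx T P = 1%:M by rewrite mul_row_col.
  by apply: sqr_unitz; have /mulmx1_unit[_] := inv; rewrite unitmxE.
rewrite mulrAC -det_mulmx mul_col_row TZ PZ det_ublock det1 mul1r mulrC.
by rewrite -det_mulmx mulmxA -AE.
Qed.

(** A vector v with v A A^T = 0 satisfies |v A|^2 = 0, so v M = v A Q = 0. *)
Lemma det_gram_neq0 n r (A : 'M[int]_(r, n)) M (P : 'M[int]_(r, n)) Q :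
  A = M *m P -> P *m Q = 1%:M -> \det M != 0 -> \det (A *m A^T) != 0.
Proof.
move=> AE PQ; apply: contra => /det0P[v nz_v vAA].
apply/det0P; exists v => //; suff vA : v *m A = 0.
  by rewrite -[M]mulmx1 -PQ (mulmxA M) -AE mulmxA vA mul0mx.
have /matrixP/(_ 0 0) : (v *m A) *m (v *m A)^T = 0.
  by rewrite trmx_mul mulmxA -(mulmxA v) vAA mul0mx.
rewrite !mxE => /eqP; rewrite psumr_eq0 => [/allP vA0|j _]; last first.
  by rewrite [X in _ * X]mxE -expr2 sqr_ge0.
apply/rowP => j; have := vA0 j (mem_index_enum _).
by rewrite [X in _ * X]mxE -expr2 sqrf_eq0 /= => /eqP ->; rewrite mxE.
Qed.

(** On ker A the winding number is proportional to the bordered determinant: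
    up to a unimodular change the columns of B are those of A'^T, and writing
    z and A'^T in the basis Z makes (z, A'^T, A^T) the product of (Z, A^T) with
    a block diagonal matrix. *)
Lemma lattice_det_bordered r s (A : 'M[int]_(r, s.+1 + r))
    (A' : 'M[int]_(s, s.+1 + r)) Z B :
  A *m A'^T = 0 -> Zbasis (kerZ A) Z -> Zbasis (imZ A'^T) B ->
  exists e : int, e ^+ 2 = 1 /\ forall z, A *m z = 0 ->
    lattice_det Z B z * \det (row_mx Z A^T) = e * \det (bordered A A' z).
Proof.
move=> AA' [inj_Z imZE] bB; have [g [h [gE hg]]] := Zbasis_factor bB (erefl _).
have [b bE] : exists b, Z *m b = A'^T.
  by apply: imZ_factor => x; rewrite imZE /kerZ /= mulmxA AA' mul0mx.
exists (\det g); split.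
  by apply: sqr_unitz; have /mulmx1_unit[_] := hg; rewrite unitmxE.
move=> z Az; have [k _ kE] : imZ Z z by rewrite imZE.
have -> : lattice_det Z B z = \det (row_mx k b : 'M_(1 + s)) * \det g.
  rewrite /lattice_det (coord_mx_unique inj_Z kE).
  have bgE : Z *m (b *m g) = B by rewrite mulmxA bE.
  rewrite (coord_mx_unique inj_Z bgE).
  have -> : row_mx k (b *m g) =
      (row_mx k b : 'M_(1 + s)) *m block_mx 1%:M 0 0 g.
    by rewrite mul_row_block !mulmx0 mulmx1 addr0 add0r.
  rewrite det_mulmx; congr (_ * _).
  have := det_ublock (1%:M : 'M_1) 0 g; rewrite det1 mul1r; exact.
rewrite mulrAC mulrC; congr (_ * _).
have -> : bordered A A' z =
    row_mx Z A^T *m block_mx (row_mx k b : 'M_(1 + s)) 0 0 1%:M.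
  by rewrite mul_row_block !mulmx0 mulmx1 addr0 add0r mul_mx_row kE bE.
by rewrite det_mulmx det_ublock det1 mulr1 mulrC.
Qed.

(** The weighted sum of the C_U is det M times the vector eta representing the
    bordered determinant, up to sign.  With delta = det (Z, A^T), delta times
    the weight of C_U is the product of eta and C_U up to sign; summing over U
    by [sum_minors_cycle] and using A eta = 0, delta times the sum is
    det (A A^T) eta, and det (A A^T) = +- det M delta. *)
Lemma harmonic_sum n r s (A : 'M[int]_(r, n)) (A' : 'M[int]_(s, n)) M P Q
    (Z : 'M[int]_(n, s.+1)) (B : 'M[int]_(n, s)) :
  n = (s.+1 + r)%N -> A *m A'^T = 0 ->
  A = M *m P -> P *m Q = 1%:M -> \det M != 0 ->
  Zbasis (kerZ A) Z -> Zbasis (imZ A'^T) B ->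
  exists eta : 'cV[int]_n,
    (\sum_(U : cycletree n r)
       lattice_det Z B (minors_cycle A U) *: minors_cycle A U =
     `|\det M| *: eta) /\
    forall x : 'cV[int]_n,
      (eta^T *m x) 0 0 ^+ 2 = \det (x *m x^T + A'^T *m A' + A^T *m A).
Proof.
move=> def_n; subst n => AA' AE PQ nzM bZ bB.
have [t [t1 tE]] := det_ker_rows AE PQ nzM bZ.
have [e [e1 eE]] := lattice_det_bordered AA' bZ bB.
have [eta etaE] := det_bordered_dot A A'.
have nzAA := det_gram_neq0 AE PQ nzM.
set delta := \det (row_mx Z A^T) in tE eE.
have nz_delta : delta != 0 by apply: contraNneq nzAA => d0; rewrite tE d0 mulr0.
have Aeta : eta^T *m A^T = 0.
  apply/rowP => j; rewrite [RHS]mxE.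
  have := etaE (A^T *m delta_mx j 0); rewrite det_bordered_row_space => ->.
  by rewrite mulmxA -colE [RHS]mxE.
set lam := \sum_U _.
have lamE : delta *: lam = (e * \det (A *m A^T)) *: eta.
  apply: eq_dot => z; rewrite -!scalemxAr [LHS]mxE [RHS]mxE.
  rewrite /lam mulmx_sumr summxE.
  transitivity (\sum_U e * ((eta^T *m minors_cycle A U) 0 0 *
                            (z^T *m minors_cycle A U) 0 0)).
    rewrite mulr_sumr; apply: eq_bigr => U _.
    rewrite -scalemxAr [X in delta * X]mxE.
    by rewrite mulrC mulrAC eE ?mulmx_minors_cycle // etaE -mulrA.
  rewrite -mulr_sumr sum_minors_cycle Aeta det_lblock.
  rewrite -mulrA; congr (_ * _); rewrite mulrC; congr (_ * _).
  by rewrite det_mx11 -[eta^T *m z]trmxK trmx_mul trmxK [LHS]mxE.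
have nz_absM : `|\det M| != 0 by rewrite normr_eq0.
exists ((e * t * Num.sg (\det M)) *: eta); split.
  apply: (scalemx_inj nz_delta); rewrite lamE tE !scalerA; congr (_ *: _).
  rewrite {1}(numEsg (\det M)); ring.
move=> x; rewrite linearZ -scalemxAl mxE exprMn !exprMn e1 t1 sqr_sg nzM !mul1r.
by rewrite -etaE det_bordered_sqr.
Qed.

(** D and E stand for the boundary and the coboundary out of the i-chains, D0
    and E0 for the maps that follow them; the cycle and the cocycle are both of
    this form.  Exchanging (D, D0) and (E, E0) only swaps the last two summands
    in the formula for the squares. *)
Lemma harmonic_sum_complex m0 m n p q r s r'
    (D0 : 'M[int]_(m0, m)) (D : 'M[int]_(m, n))
    (E : 'M[int]_(p, n)) (E0 : 'M[int]_(q, p))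
    (Y : 'M[int]_(m, r)) (Y' : 'M[int]_(p, r'))
    (Z : 'M[int]_(n, s.+1)) (B : 'M[int]_(n, s)) :
  D0 *m D = 0 -> E0 *m E = 0 -> D *m E^T = 0 ->
  torsion_at D0 D -> torsion_at E0 E ->
  Zbasis (kerZ D0) Y -> Zbasis (kerZ E0) Y' ->
  Zbasis (kerZ D) Z -> Zbasis (imZ E^T) B ->
  exists eta : 'cV[int]_n, [/\
    group_order (homology D0 D) != 0%N,
    \sum_(U : cycletree n r) lattice_det Z B (tree_vec D Y U) *: tree_vec D Y U
      = (group_order (homology D0 D))%:Z *: eta &
    forall x : 'cV[int]_n, (eta^T *m x) 0 0 ^+ 2 =
      \det (x *m x^T + (coord_mx Y' E)^T *m coord_mx Y' E
                     + (coord_mx Y D)^T *m coord_mx Y D)].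
Proof.
move=> D0D E0E DE torD torE bY bY' bZ bB.
have YA : Y *m coord_mx Y D = D.
  by apply: coord_mxK => x; rewrite bY.2 /kerZ /= mulmxA D0D mul0mx.
have YA' : Y' *m coord_mx Y' E = E.
  by apply: coord_mxK => x; rewrite bY'.2 /kerZ /= mulmxA E0E mul0mx.
rewrite /tree_vec; move: (coord_mx Y D) (coord_mx Y' E) YA YA' => A A' YA YA'.
have [M [P [Q [AE PQ nzM absM]]]] := torsion_homology_factor bY (esym YA) torD.
have [M' [P' [Q' [AE' PQ' nzM' _]]]] :=
  torsion_homology_factor bY' (esym YA') torE.
have [T TY] := ker_basis_linv bY; have [T' TY'] := ker_basis_linv bY'.
have AA' : A *m A'^T = 0.
  have -> : A = T *m D by rewrite -YA mulmxA TY mul1mx.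
  have -> : A' = T' *m E by rewrite -YA' mulmxA TY' mul1mx.
  by rewrite trmx_mul mulmxA -(mulmxA T) DE mulmx0 mul0mx.
have kerA : kerZ A = kerZ D.
  rewrite -YA /kerZ; apply/seteqP; split=> x /=; rewrite -mulmxA.
    by move=> ->; rewrite mulmx0.
  by move=> YAx; apply: bY.1; rewrite YAx mulmx0.
have imA' : imZ A'^T = imZ E^T.
  apply/seteqP; split=> _ [x _ <-].
    exists (T'^T *m x) => //; rewrite mulmxA -trmx_mul -YA' mulmxA TY'.
    by rewrite mul1mx.
  by exists (Y'^T *m x) => //; rewrite mulmxA -trmx_mul YA'.
have bA' : Zbasis (imZ A'^T) A'^T.
  split=> // x y; rewrite AE' trmx_mul -!mulmxA.
  move=> /(mulmx_linv_inj (T := Q'^T)).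
  rewrite -trmx_mul PQ' trmx1 => /(_ erefl).
  by apply: mulmx_det_inj; rewrite det_tr.
rewrite -kerA in bZ; rewrite -imA' in bB.
have eq_sr' : s = r' := Zbasis_size bB bA'; subst r'.
have [|eta [sumE etaE]] := harmonic_sum _ AA' AE PQ nzM bZ bB.
  exact: ker_basis_size AE PQ nzM bZ.
exists eta; split=> //; last by rewrite -absM; exact: sumE.
by rewrite -eqz_nat -absM normr_eq0.
Qed.

(** * Comparison of the two sides *)

Theorem theorem8p0p2 (d : nat) (X : cell_complex d) (i : nat) (le_id : (i <= d)%N)
    (rk_next : has_rank (rhomology X i.+2) 0)
    (rk_cur : has_rank (rhomology X i.+1) 1)
    (rk_prev : has_rank (rhomology X i) 0)
    (r s r' s' : nat)
    (Zprev : 'M[int]_(chain_rk X i.+1, r))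
    (Zi : 'M[int]_(ncells X i, s.+1)) (Bi : 'M[int]_(ncells X i, s))
    (coZnext : 'M[int]_(chain_rk X i.+3, r'))
    (coZi : 'M[int]_(ncells X i, s'.+1)) (coBi : 'M[int]_(ncells X i, s'))
    (basis_Zprev : Zbasis (kerZ (bdry X i)) Zprev)
    (basis_Zi : Zbasis (kerZ (bdry X i.+1)) Zi)
    (basis_Bi : Zbasis (imZ (bdry X i.+2)) Bi)
    (basis_coZnext : Zbasis (kerZ (cobdry X i.+3)) coZnext)
    (basis_coZi : Zbasis (kerZ (cobdry X i.+2)) coZi)
    (basis_coBi : Zbasis (imZ (cobdry X i.+1)) coBi) :
  let lhs : 'cV[rat]_(ncells X i) :=
    (group_order (rhomology X i))%:R^-1 *:
      map_mx intr (harmonic_cycle Zprev Zi Bi) in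
  let rhs : 'cV[rat]_(ncells X i) :=
    (group_order (rcohomology X i.+2))%:R^-1 *:
      map_mx intr (harmonic_cocycle coZnext coZi coBi) in
  lhs = rhs \/ lhs = - rhs.
Proof.
move=> lhs rhs.
have DE : bdry X i.+1 *m (cobdry X i.+2)^T = 0 by rewrite trmxK bdry_bdry.
have ED : cobdry X i.+2 *m (bdry X i.+1)^T = 0 by exact: cobdry_cobdry.
have tor_prev : torsion_at (bdry X i) (bdry X i.+1) := homology_torsion rk_prev.
have tor_next : torsion_at (cobdry X i.+3) (cobdry X i.+2).
  by apply: torsion_at_tr; [exact: bdry_bdry | exact: homology_torsion rk_next].
have [|eta [nz_h lamE etaE]] :=
  harmonic_sum_complex (bdry_bdry X i) (cobdry_cobdry X i.+2) DE
    tor_prev tor_next basis_Zprev basis_coZnext basis_Zi (B := Bi).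
  by rewrite trmxK.
have [eta' [nz_h' lamE' etaE']] :=
  harmonic_sum_complex (cobdry_cobdry X i.+2) (bdry_bdry X i) ED
    tor_next tor_prev basis_coZnext basis_Zprev basis_coZi basis_coBi.
have cancel_order (h : nat) (lam v : 'cV[int]_(ncells X i)) : h != 0%N ->
    lam = h%:Z *: v -> (h%:R : rat)^-1 *: map_mx intr lam = map_mx intr v.
  move=> nz_h0 ->; apply/colP => k; rewrite !mxE rmorphM /=.
  by rewrite mulKf // pnatr_eq0.
have lhsE : lhs = map_mx intr eta := cancel_order _ _ _ nz_h lamE.
have rhsE : rhs = map_mx intr eta' := cancel_order _ _ _ nz_h' lamE'.
rewrite lhsE rhsE; have [x|->|->] := @eq_sqr_dot _ eta eta'.
- by rewrite etaE etaE' addrAC.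
- by left.
- by right; rewrite map_mxN.
Qed.
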